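(* Let $m\ge 1$ be an integer, and let $A_i\in\mathbb{C}^{n\times n}$, $B_{i,k}\in\mathbb{C}^{n\times n}$ ($k=0,\dots,m$) and $C_{i,k}\in\mathbb{C}^{n\times n}$ ($k=1,\dots,m$) be given for $i=1,2$. Consider the polynomial two-parameter eigenvalue problem $$ \left\{ \begin{array}{l} A_1x=\lambda \displaystyle\sum_{k=0}^m\mu^kB_{1,k}x+\sum_{k=1}^m\mu^kC_{1,k}x,\\[4mm] A_2y=\lambda \displaystyle\sum_{k=0}^m\mu^kB_{2,k}y+\sum_{k=1}^m\mu^kC_{2,k}y. \end{array} \right. $$ If $(\lambda,\mu)\in\mathbb{C}^2$ is an eigenvalue of this problem with eigenvector $(x,y)$, $x,y\in\mathbb{C}^n\setminus\{0\}$, then $$ \Big[(A_1\otimes B_{2,0}-B_{1,0}\otimes A_2)+\sum_{k=1}^m\mu^k\big(A_1\otimes B_{2,k}-B_{1,k}\otimes A_2-C_{1,k}\otimes B_{2,0}+B_{1,0}\otimes C_{2,k}\big)+\sum_{k=1}^m\sum_{i=1}^m\mu^{k+i}\big(B_{1,k}\otimes C_{2,i}-C_{1,k}\otimes B_{2,i}\big)\Big](x\otimes y)=0. $$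
   Context: $\otimes$ denotes the Kronecker product. A pair $(\lambda,\mu)\in\mathbb{C}^2$ is an eigenvalue of a polynomial two-parameter eigenvalue problem with eigenvector $(x,y)$ if $x,y\in\mathbb{C}^n$ are nonzero and both equations hold. *)

(* Defs.v *)
From mathcomp Require Import all_boot all_order all_algebra.
From mathcomp Require Export mxtens complex.
From mathcomp Require Export reals.

Set Implicit Arguments.
Unset Strict Implicit.
Unset Printing Implicit Defensive.

Import GRing.Theory.
Local Open Scope ring_scope.

(* Coefficients are families indexed by nat, of which only the entries B k for
   0 <= k <= m and C k for 1 <= k <= m are ever used. *)

Definition pep2_equation (K : fieldType) (n m : nat) (A : 'M[K]_n)
    (B C : nat -> 'M[K]_n) (lambda mu : K) (v : 'cV[K]_n) : Prop :=
  A *m v = lambda *: (\sum_(0 <= k < m.+1) mu ^+ k *: (B k *m v))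
           + \sum_(1 <= k < m.+1) mu ^+ k *: (C k *m v).

Definition pep2_eigenvalue_with (K : fieldType) (n m : nat) (A1 A2 : 'M[K]_n)
    (B1 B2 C1 C2 : nat -> 'M[K]_n) (lambda mu : K) (x y : 'cV[K]_n) : Prop :=
  [/\ x != 0, y != 0,
      pep2_equation m A1 B1 C1 lambda mu x
    & pep2_equation m A2 B2 C2 lambda mu y].

(* Main.v *)
Require Import Defs.
From mathcomp Require Import all_boot all_order all_algebra.
From mathcomp Require Import mxtens complex reals.
From mathcomp Require Import ring.

(** Put [P_i = \sum_(0 <= k <= m) mu ^+ k *: B_i k] and
    [Q_i = \sum_(1 <= k <= m) mu ^+ k *: C_i k].  The two equations say that
    [(A1 - Q1) *m x = lambda *: (P1 *m x)] and
    [(A2 - Q2) *m y = lambda *: (P2 *m y)], so for fixed [mu] they form a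
    generalized eigenvalue problem in each variable with the same eigenvalue
    [lambda].  The operator determinant [(A1 - Q1) *t P2 - P1 *t (A2 - Q2)]
    then maps [x *t y] to
    [lambda *: (P1 *m x *t P2 *m y) - lambda *: (P1 *m x *t P2 *m y) = 0]
    ([mul_operator_determinant_eq0]).  Expanding this determinant in powers of
    [mu] by bilinearity of the Kronecker product, with the constant terms
    [B_i 0] split off from [P_i], gives the matrix of the theorem
    ([operator_determinant_expansion]). *)

Import GRing.Theory.
Local Open Scope ring_scope.

Section TensBilinear.
Context {K : comPzRingType} {m n p q : nat}.
Implicit Types (A : 'M[K]_(m, n)) (B : 'M[K]_(p, q)).

Lemma tensmxDl A A' B : (A + A') *t B = A *t B + A' *t B.
Proof. by apply/matrixP=> i j; rewrite !mxE mulrDl. Qed.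

Lemma tensmxDr A B B' : A *t (B + B') = A *t B + A *t B'.
Proof. by apply/matrixP=> i j; rewrite !mxE mulrDr. Qed.

Lemma tensmxNl A B : (- A) *t B = - (A *t B).
Proof. by apply/matrixP=> i j; rewrite !mxE mulNr. Qed.

Lemma tensmxNr A B : A *t (- B) = - (A *t B).
Proof. by apply/matrixP=> i j; rewrite !mxE mulrN. Qed.

Lemma tensmxZl a A B : (a *: A) *t B = a *: (A *t B).
Proof. by apply/matrixP=> i j; rewrite !mxE mulrA. Qed.

Lemma tensmxZr a A B : A *t (a *: B) = a *: (A *t B).
Proof. by apply/matrixP=> i j; rewrite !mxE mulrCA. Qed.

Lemma tensmx_suml (I : Type) (r : seq I) (F : I -> 'M[K]_(m, n)) B :
  (\sum_(k <- r) F k) *t B = \sum_(k <- r) F k *t B.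
Proof.
by apply: (big_morph (fun A => A *t B)) => [A A'|]; rewrite ?tensmxDl ?tens0mx.
Qed.

Lemma tensmx_sumr (I : Type) (r : seq I) A (F : I -> 'M[K]_(p, q)) :
  A *t (\sum_(k <- r) F k) = \sum_(k <- r) A *t F k.
Proof.
by apply: (big_morph (fun B => A *t B)) => [B B'|]; rewrite ?tensmxDr ?tensmx0.
Qed.

End TensBilinear.

(** Both Kronecker products send [x *t y] to the same multiple of
    [P1 *m x *t P2 *m y], because the two problems share [lambda]. *)
Lemma mul_operator_determinant_eq0 (K : comPzRingType) (n1 n2 : nat)
    (D1 P1 : 'M[K]_n1) (D2 P2 : 'M[K]_n2) (lambda : K)
    (x : 'cV[K]_n1) (y : 'cV[K]_n2) :
  D1 *m x = lambda *: (P1 *m x) -> D2 *m y = lambda *: (P2 *m y) ->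
  (D1 *t P2 - P1 *t D2) *m (x *t y) = 0.
Proof.
move=> eq_x eq_y.
by rewrite mulmxBl !tensmx_mul eq_x eq_y tensmxZl tensmxZr subrr.
Qed.

(** The constant term [B 0] is kept apart from the sum because the expanded
    determinant treats it separately: no [C 0] is paired with it. *)
Lemma pep2_equation_pencil (K : fieldType) (n m : nat) (A : 'M[K]_n)
    (B C : nat -> 'M[K]_n) (lambda mu : K) (v : 'cV[K]_n) :
  pep2_equation m A B C lambda mu v ->
  (A - \sum_(1 <= k < m.+1) mu ^+ k *: C k) *m v
    = lambda *: ((B 0%N + \sum_(1 <= k < m.+1) mu ^+ k *: B k) *m v).
Proof.
rewrite /pep2_equation => eq_v.
have mulE (F : nat -> 'M[K]_n) :
    (\sum_(1 <= k < m.+1) mu ^+ k *: F k) *m v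
      = \sum_(1 <= k < m.+1) mu ^+ k *: (F k *m v).
  by rewrite mulmx_suml; apply: eq_bigr => k _; rewrite scalemxAl.
by rewrite mulmxBl mulmxDl !mulE eq_v addrK big_ltn // expr0 scale1r.
Qed.

Section Expansion.
Context {K : comPzRingType} {n1 n2 : nat} (m : nat) (mu : K).
Implicit Types (F : nat -> 'M[K]_n1) (G : nat -> 'M[K]_n2).

Lemma tensmx_powers_double_sum F G :
  (\sum_(1 <= k < m.+1) mu ^+ k *: F k) *t (\sum_(1 <= i < m.+1) mu ^+ i *: G i)
    = \sum_(1 <= k < m.+1) \sum_(1 <= i < m.+1) mu ^+ (k + i) *: (F k *t G i).
Proof.
rewrite tensmx_suml; apply: eq_bigr => k _; rewrite tensmx_sumr.
by apply: eq_bigr => i _; rewrite tensmxZl tensmxZr scalerA exprD.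
Qed.

Lemma operator_determinant_expansion (A1 : 'M[K]_n1) (A2 : 'M[K]_n2)
    (B1 C1 : nat -> 'M[K]_n1) (B2 C2 : nat -> 'M[K]_n2) :
  (A1 *t B2 0%N - B1 0%N *t A2)
  + \sum_(1 <= k < m.+1)
      mu ^+ k *: (A1 *t B2 k - B1 k *t A2 - C1 k *t B2 0%N + B1 0%N *t C2 k)
  + \sum_(1 <= k < m.+1) \sum_(1 <= i < m.+1)
      mu ^+ (k + i) *: (B1 k *t C2 i - C1 k *t B2 i)
  = (A1 - \sum_(1 <= k < m.+1) mu ^+ k *: C1 k)
      *t (B2 0%N + \sum_(1 <= k < m.+1) mu ^+ k *: B2 k)
    - (B1 0%N + \sum_(1 <= k < m.+1) mu ^+ k *: B1 k)
      *t (A2 - \sum_(1 <= k < m.+1) mu ^+ k *: C2 k).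
Proof.
have tensl F (N : 'M[K]_n2) : \sum_(1 <= k < m.+1) mu ^+ k *: (F k *t N)
    = (\sum_(1 <= k < m.+1) mu ^+ k *: F k) *t N.
  by rewrite tensmx_suml; apply: eq_bigr => k _; rewrite tensmxZl.
have tensr (M : 'M[K]_n1) G : \sum_(1 <= k < m.+1) mu ^+ k *: (M *t G k)
    = M *t (\sum_(1 <= k < m.+1) mu ^+ k *: G k).
  by rewrite tensmx_sumr; apply: eq_bigr => k _; rewrite tensmxZr.
under eq_bigr do rewrite scalerDr !scalerBr.
rewrite big_split !sumrB /= !tensl !tensr.
under [X in _ + X = _]eq_bigr => k _.
  under eq_bigr do rewrite scalerBr.
  rewrite sumrB; over.
rewrite sumrB /= -!tensmx_powers_double_sum.
rewrite !(tensmxDl, tensmxDr, tensmxNl, tensmxNr).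
(* What remains is an identity between sums of the same eight tensor products;
   matrices of arbitrary size form no ring, so it is checked entry by entry. *)
by apply/matrixP => i j; rewrite !mxE; ring.
Qed.

End Expansion.

Theorem theorem4 (R : realType) (n m : nat) (hm : (1 <= m)%N)
    (A1 A2 : 'M[R[i]%C]_n) (B1 B2 C1 C2 : nat -> 'M[R[i]%C]_n)
    (lambda mu : R[i]%C) (x y : 'cV[R[i]%C]_n) :
  pep2_eigenvalue_with m A1 A2 B1 B2 C1 C2 lambda mu x y ->
  ((A1 *t B2 0%N - B1 0%N *t A2)
   + \sum_(1 <= k < m.+1)
       mu ^+ k *: (A1 *t B2 k - B1 k *t A2 - C1 k *t B2 0%N + B1 0%N *t C2 k)
   + \sum_(1 <= k < m.+1) \sum_(1 <= i < m.+1)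
       mu ^+ (k + i) *: (B1 k *t C2 i - C1 k *t B2 i)) *m (x *t y) = 0.
Proof.
case=> _ _ /pep2_equation_pencil eq_x /pep2_equation_pencil eq_y.
rewrite operator_determinant_expansion.
exact: mul_operator_determinant_eq0 eq_x eq_y.
Qed.
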